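(* Let $H,K$ be Hilbert spaces and let $T$ be a densely defined closable operator from $D(T)\subset H$ into $K$ which has decomposable domain, $D(T)=N(T)\oplus^{\perp}C(T)$, and satisfies $N(\overline{T})=\overline{N(T)}$. Then $(TT^{*})^{\dagger}\supset(T^{*})^{\dagger}T^{\dagger}$.
   Context: Operators are linear and defined on a linear subspace $D(T)$ (the domain) of a Hilbert space; $N(T)$ and $R(T)$ are the null space and range. The carrier of $T$ is $C(T)=D(T)\cap N(T)^{\perp}$. $\oplus^{\perp}$ denotes orthogonal direct sum of subspaces. $T$ has decomposable domain if $D(T)=N(T)\oplus^{\perp}C(T)$; every closed operator has decomposable domain, since its null space is closed. For $T$ with decomposable domain, the Moore-Penrose (generalized) inverse is the linear operator $T^{\dagger}:D(T^{\dagger})=R(T)\oplus^{\perp}R(T)^{\perp}\subset K\to H$ determined by $T^{\dagger}y=(T|_{C(T)})^{-1}y$ for $y\in R(T)$ and $T^{\dagger}y=0$ for $y\in R(T)^{\perp}$. The assertion is understood to include that the operators to which $\dagger$ is applied have decomposable domain. $T$ is closable if it has a closed extension; $\overline{T}$ is its minimal closed extension. $T^{*}$ is the adjoint of a densely defined operator. Products have natural domain $D(AB)=\{x\in D(B):Bx\in D(A)\}$. $B\supset A$ for operators means that $B$ extends $A$: $D(A)\subset D(B)$ and $Bx=Ax$ for $x\in D(A)$. *)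

(* Defs.v *)
From HB Require Import structures.
From mathcomp Require Import all_boot all_order all_algebra.
From mathcomp Require Import sesquilinear.
From mathcomp Require Import complex.
From mathcomp Require Import all_classical reals topology normedtype.

Set Implicit Arguments.
Unset Strict Implicit.
Unset Printing Implicit Defensive.

Import Order.TTheory GRing.Theory Num.Theory.
Import numFieldNormedType.Exports.

Local Open Scope classical_set_scope.
Local Open Scope ring_scope.

(* Hilbert spaces may be real or complex. *)
Inductive scalar_kind := RealScalars | ComplexScalars.

Definition scalars (R : realType) (k : scalar_kind) : numFieldType :=
  match k with
  | RealScalars => R
  | ComplexScalars => R[i]%C
  end.

Definition sconj (R : realType) (k : scalar_kind) :
    {rmorphism scalars R k -> scalars R k} :=
  match k with
  | RealScalars => idfun
  | ComplexScalars => Num.conj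
  end.

(* The inner product is linear in the first argument and conjugate-linear in
   the second. *)
Record hilbertType (R : realType) (k : scalar_kind) := Hilbert {
  hilbert_sort :> completeNormedModType (scalars R k) ;
  dot : {dot hilbert_sort for sconj R k} ;
  dot_norm : forall x : hilbert_sort, dot x x = `|x| ^+ 2
}.
Arguments dot {R k} h.

Notation "''[' x , y ]" := (dot _ x y) : ring_scope.

Section Subspaces.
Context {R : realType} {k : scalar_kind} {H : hilbertType R k}.
Implicit Types A B : set H.

Definition linear_subspace A : Prop :=
  A 0 /\ forall (a : scalars R k) (x y : H), A x -> A y -> A (a *: x + y).

Definition orth A : set H := [set x | forall y, A y -> '[x, y] = 0].

(* Used only when A and B are mutually orthogonal, where it is the orthogonal
   direct sum. *)
Definition osum A B : set H := [set x + y | x in A & y in B].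

Lemma dot0l (y : H) : '[0, y] = 0. Proof. exact: linear0l. Qed.

Lemma dotPl a (x y z : H) : '[a *: x + y, z] = a * '[x, z] + '[y, z].
Proof. by rewrite linearDl /= linearZl_LR. Qed.

Lemma dot0r (x : H) : '[x, 0] = 0. Proof. exact: linear0r. Qed.

Lemma dotPr a (x y z : H) : '[x, a *: y + z] = sconj R k a * '[x, y] + '[x, z].
Proof. by rewrite linearDr /= linearZr_LR. Qed.

Lemma dotBr (x y z : H) : '[x, y - z] = '[x, y] - '[x, z].
Proof. exact: linearBr. Qed.

Lemma dotC (x y : H) : '[x, y] = sconj R k '[y, x].
Proof. by rewrite (hermC (dot H)) expr0 mul1r. Qed.

Lemma dot_eq0 (x : H) : '[x, x] = 0 -> x = 0.
Proof. by rewrite dot_norm => /eqP; rewrite expf_eq0 normr_eq0 => /eqP. Qed.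

Lemma orth_self A x : A x -> orth A x -> x = 0.
Proof. by move=> Ax /(_ _ Ax) /dot_eq0. Qed.

Lemma orth_subspace A : linear_subspace (orth A).
Proof.
split=> [y _|a x y ox oy z Az]; first exact: dot0l.
by rewrite dotPl ox // oy // mulr0 addr0.
Qed.

Lemma osum_subspace A B :
  linear_subspace A -> linear_subspace B -> linear_subspace (osum A B).
Proof.
move=> [A0 AP] [B0 BP]; split; first by exists 0 => //; exists 0; rewrite ?addr0.
move=> a _ _ [x Ax [y By <-]] [z Az [t Bt <-]].
exists (a *: x + z); first exact: AP.
by exists (a *: y + t); [exact: BP | rewrite scalerDr addrACA].
Qed.

Lemma orth_dense A (x : H) : dense A -> (forall y, A y -> '[y, x] = 0) -> x = 0.
Proof.
move=> dA oA; apply/eqP/negPn/negP => x0.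
have nx : 0 < `|x| by rewrite normr_gt0.
have [|z [/= xz Az]] := dA (ball x `|x|) _ (ball_open x _).
  by exists x; exact: ballxx.
move: xz; rewrite -ball_normE /= => xz.
have : `|x| ^+ 2 <= `|x - z| ^+ 2.
  have xz0 : '[x, z] = 0 by rewrite dotC oA // rmorph0.
  have E : '[x - z, x - z] = '[x, x] + '[z, z] by exact: hnormBd.
  by rewrite -!dot_norm E lerDl dot_norm exprn_ge0.
by rewrite ler_sqr ?nnegrE ?normr_ge0 // => /(lt_le_trans xz); rewrite ltxx.
Qed.

End Subspaces.

(* The values of app outside dom are irrelevant. *)
Record operator (R : realType) (k : scalar_kind) (H K : hilbertType R k) :=
  Operator {
  dom : set H ;
  app :> H -> K ;
  dom_subspace : linear_subspace dom ;
  app_linear : forall (a : scalars R k) (x y : H), dom x -> dom y ->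
    app (a *: x + y) = a *: app x + app y
}.

Section Operators.
Context {R : realType} {k : scalar_kind} {H K : hilbertType R k}.
Implicit Types S T : operator H K.

Definition null T : set H := [set x | dom T x /\ T x = 0].
Definition ran T : set K := T @` dom T.
Definition carrier T : set H := dom T `&` orth (null T).
Definition graph T : set (H * K) := [set p | dom T p.1 /\ T p.1 = p.2].

Definition extends S T : Prop :=
  dom T `<=` dom S /\ forall x, dom T x -> S x = T x.

Definition densely_defined T : Prop := dense (dom T).
Definition decomposable T : Prop := dom T = osum (null T) (carrier T).
Definition closed_op T : Prop := closed (graph T).
Definition closable T : Prop := exists2 S, closed_op S & extends S T.

Lemma app0 T : T 0 = 0.
Proof.
have [D0 _] := dom_subspace T.
have := app_linear (-1) D0 D0.
by rewrite scaler0 addr0 scaleN1r addNr.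
Qed.

Lemma appB T x y : dom T x -> dom T y -> dom T (x - y) /\ T (x - y) = T x - T y.
Proof.
move=> Tx Ty; rewrite addrC -scaleN1r; split; first exact: (dom_subspace T).2.
by rewrite app_linear // scaleN1r addrC.
Qed.

Lemma null_subspace T : linear_subspace (null T).
Proof.
have [D0 DP] := dom_subspace T.
split=> [|a x y [Dx Tx] [Dy Ty]]; first by split; rewrite ?app0.
by split; [exact: DP | rewrite app_linear // Tx Ty scaler0 addr0].
Qed.

Lemma ran_subspace T : linear_subspace (ran T).
Proof.
have [D0 DP] := dom_subspace T.
split=> [|a _ _ [x Dx <-] [y Dy <-]]; first by exists 0; rewrite ?app0.
by exists (a *: x + y); [exact: DP | rewrite app_linear].
Qed.

Lemma carrier_subspace T : linear_subspace (carrier T).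
Proof.
have [D0 DP] := dom_subspace T; have [O0 OP] := orth_subspace (null T).
by split=> // a x y [? ?] [? ?]; split; [exact: DP | exact: OP].
Qed.

Lemma null_carrier_orth T x y : null T x -> carrier T y -> '[x, y] = 0.
Proof. by move=> Nx [_ /(_ _ Nx) yx]; rewrite dotC yx rmorph0. Qed.

Lemma carrier_inj T x y : carrier T x -> carrier T y -> T x = T y -> x = y.
Proof.
move=> Cx Cy Txy; have [C0 CP] := carrier_subspace T.
have [Dxy Exy] := appB Cx.1 Cy.1.
have Cxy : carrier T (x - y) by rewrite addrC -scaleN1r; exact: CP.
have Nxy : null T (x - y) by split=> //; rewrite Exy Txy subrr.
by apply/eqP; rewrite -subr_eq0 (orth_self Nxy Cxy.2).
Qed.

Lemma ran_carrier T y : decomposable T -> ran T y -> exists2 x, carrier T x & T x = y.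
Proof.
move=> dT [x + <-]; rewrite {1}dT => -[n [Dn Tn] [c Cc <-]]; exists c => //.
by rewrite -[n]scale1r app_linear ?Tn ?scaler0 ?add0r //; exact: Cc.1.
Qed.

(* The operator whose graph is a given single-valued linear relation. *)
Section OperatorOfGraph.
Variable G : H -> K -> Prop.
Hypothesis G0 : G 0 0.
Hypothesis GP : forall a x x' y y', G x y -> G x' y' -> G (a *: x + x') (a *: y + y').
Hypothesis Gfun : forall x y y', G x y -> G x y' -> y = y'.

Definition rel_dom : set H := [set x | exists y, G x y].
Definition rel_app (x : H) : K := xget 0 [set y | G x y].

Lemma rel_appE x y : G x y -> rel_app x = y.
Proof. by rewrite /rel_app; move=> Gy; apply: (Gfun _ Gy); apply: xgetPex; exists y. Qed.

Lemma rel_dom_subspace : linear_subspace rel_dom.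
Proof. by split=> [|a x x' [y Gy] [y' Gy']]; [exists 0 | exists (a *: y + y'); exact: GP]. Qed.

Lemma rel_app_linear a x x' : rel_dom x -> rel_dom x' ->
  rel_app (a *: x + x') = a *: rel_app x + rel_app x'.
Proof.
move=> [y Gy] [y' Gy']; rewrite (rel_appE Gy) (rel_appE Gy').
by apply: rel_appE; exact: GP.
Qed.

Definition rel_op : operator H K := Operator rel_dom_subspace rel_app_linear.

Lemma rel_opP x y : dom rel_op x /\ rel_op x = y <-> G x y.
Proof.
split=> [[[z Gz] /= <-]|Gy]; first by rewrite (rel_appE Gz).
by split; [exists y | exact: rel_appE].
Qed.

End OperatorOfGraph.

(* The minimal closed extension: its graph is the intersection of the graphs of
   all closed extensions. *)
Section Closure.
Variables (T : operator H K) (clT : closable T).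

Definition closure_rel (x : H) (y : K) : Prop :=
  forall S, closed_op S -> extends S T -> dom S x /\ S x = y.

Lemma closure_rel0 : closure_rel 0 0.
Proof. by move=> S _ _; split; [exact: (dom_subspace S).1 | exact: app0]. Qed.

Lemma closure_relP a x x' y y' : closure_rel x y -> closure_rel x' y' ->
  closure_rel (a *: x + x') (a *: y + y').
Proof.
move=> cx cx' S cS eS; have [Dx <-] := cx S cS eS; have [Dx' <-] := cx' S cS eS.
by split; [exact: (dom_subspace S).2 | exact: app_linear].
Qed.

Lemma closure_rel_fun x y y' : closure_rel x y -> closure_rel x y' -> y = y'.
Proof.
by case: clT => S cS eS /(_ S cS eS)[_ <-] /(_ S cS eS)[_ <-].
Qed.

Definition closure_op : operator H K :=
  rel_op closure_rel0 closure_relP closure_rel_fun.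

Lemma closure_opP x y : dom closure_op x /\ closure_op x = y <-> closure_rel x y.
Proof. exact: rel_opP. Qed.

Lemma closure_op_closed : closed_op closure_op.
Proof.
have -> : closed_op closure_op =
    closed (\bigcap_(S in [set S | closed_op S /\ extends S T]) graph S).
  congr closed; apply/seteqP; split=> -[x y].
    by move=> /closure_opP cxy S [cS eS]; exact: cxy.
  by move=> cxy; apply/closure_opP => S cS eS; exact: (cxy S).
by apply: closed_bigI => S [].
Qed.

Lemma closure_op_extends : extends closure_op T.
Proof.
have cT x : dom T x -> closure_rel x (T x).
  by move=> Dx S _ [DS ES]; split; [exact: DS | exact: ES].
by split=> x /cT /closure_opP[].
Qed.

Lemma closure_op_min S : closed_op S -> extends S T -> extends S closure_op.
Proof.
move=> cS eS; suff cl x : dom closure_op x -> dom S x /\ S x = closure_op x.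
  by split=> x /cl[].
move=> Dx; have /closure_opP cx : dom closure_op x /\ closure_op x = closure_op x by [].
exact: cx.
Qed.

End Closure.

End Operators.

Section Adjoint.
Context {R : realType} {k : scalar_kind} {H K : hilbertType R k}.
Variables (T : operator H K) (dT : densely_defined T).

Definition adjoint_rel (y : K) (z : H) : Prop :=
  forall x, dom T x -> '[T x, y] = '[x, z].

Lemma adjoint_rel0 : adjoint_rel 0 0.
Proof. by move=> x _; rewrite !dot0r. Qed.

Lemma adjoint_relP a y y' z z' : adjoint_rel y z -> adjoint_rel y' z' ->
  adjoint_rel (a *: y + y') (a *: z + z').
Proof. by move=> yz yz' x Dx; rewrite !dotPr yz // yz'. Qed.

Lemma adjoint_rel_fun y z z' : adjoint_rel y z -> adjoint_rel y z' -> z = z'.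
Proof.
move=> yz yz'; apply/eqP; rewrite -subr_eq0; apply/eqP.
by apply: (orth_dense dT) => x Dx; rewrite dotBr -yz // -yz' // subrr.
Qed.

Definition adjoint : operator K H :=
  rel_op adjoint_rel0 adjoint_relP adjoint_rel_fun.

Lemma adjointP y z : dom adjoint y /\ adjoint y = z <-> adjoint_rel y z.
Proof. exact: rel_opP. Qed.

End Adjoint.

Section Product.
Context {R : realType} {k : scalar_kind} {H K L : hilbertType R k}.
Variables (A : operator K L) (B : operator H K).

Definition comp_dom : set H := [set x | dom B x /\ dom A (B x)].

Lemma comp_dom_subspace : linear_subspace comp_dom.
Proof.
have [A0 AP] := dom_subspace A; have [B0 BP] := dom_subspace B.
split=> [|a x y [Bx ABx] [By ABy]]; first by split; rewrite ?app0.
by split; [exact: BP | rewrite app_linear //; exact: AP].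
Qed.

Lemma comp_app_linear (a : scalars R k) (x y : H) : comp_dom x -> comp_dom y ->
  A (B (a *: x + y)) = a *: A (B x) + A (B y).
Proof. by move=> [Bx ABx] [By ABy]; rewrite !app_linear. Qed.

Definition comp_op : operator H L :=
  @Operator _ _ _ _ comp_dom (fun x => A (B x)) comp_dom_subspace comp_app_linear.

End Product.

Section MoorePenrose.
Context {R : realType} {k : scalar_kind} {H K : hilbertType R k}.
Variables (T : operator H K) (dT : decomposable T).

Definition mp_dom : set K := osum (ran T) (orth (ran T)).

(* The linear extension of the two defining clauses: y = T x + v is sent to x,
   for x in the carrier of T and v orthogonal to the range. *)
Definition mp_rel (y : K) (x : H) : Prop :=
  carrier T x /\ exists2 v, orth (ran T) v & y = T x + v.

Definition mp_app (y : K) : H := xget 0 [set x | mp_rel y x].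

Lemma mp_rel_fun y x x' : mp_rel y x -> mp_rel y x' -> x = x'.
Proof.
move=> [Cx [v ov ->]] [Cx' [v' ov' E]]; apply: (carrier_inj Cx Cx').
have [Dx Ex] := appB Cx.1 Cx'.1.
apply/eqP; rewrite -subr_eq0 -Ex; apply/eqP.
apply: (@orth_self _ _ _ (ran T)); first by exists (x - x').
have -> : T (x - x') = (-1) *: v + v'.
  apply/eqP; rewrite Ex scaleN1r subr_eq.
  by rewrite -addrA [v' + _]addrC -E addrCA addNr addr0.
exact: (orth_subspace _).2.
Qed.

Lemma mp_relP a y y' x x' : mp_rel y x -> mp_rel y' x' ->
  mp_rel (a *: y + y') (a *: x + x').
Proof.
move=> [Cx [v ov ->]] [Cx' [v' ov' ->]]; split; first exact: (carrier_subspace T).2.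
exists (a *: v + v'); first exact: (orth_subspace _).2.
by rewrite (app_linear _ Cx.1 Cx'.1) scalerDr addrACA.
Qed.

Lemma mp_appE y x : mp_rel y x -> mp_app y = x.
Proof. by rewrite /mp_app; move=> yx; apply: (mp_rel_fun _ yx); apply: xgetPex; exists x. Qed.

Lemma mp_domP y : mp_dom y -> exists x, mp_rel y x.
Proof.
move=> [_ /(ran_carrier dT)[x Cx <-] [v ov <-]].
by exists x; split=> //; exists v.
Qed.

Lemma mp_dom_subspace : linear_subspace mp_dom.
Proof. by apply: osum_subspace; [exact: ran_subspace | exact: orth_subspace]. Qed.

Lemma mp_app_linear (a : scalars R k) y y' : mp_dom y -> mp_dom y' ->
  mp_app (a *: y + y') = a *: mp_app y + mp_app y'.
Proof.
move=> /mp_domP[x yx] /mp_domP[x' yx']; rewrite (mp_appE yx) (mp_appE yx').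
by apply: mp_appE; exact: mp_relP.
Qed.

Definition mp : operator K H := Operator mp_dom_subspace mp_app_linear.

Lemma mp_ran x : carrier T x -> mp (T x) = x.
Proof.
move=> Cx; apply: mp_appE; split=> //.
by exists 0; [exact: (orth_subspace _).1 | rewrite addr0].
Qed.

Lemma mp_orth v : orth (ran T) v -> mp v = 0.
Proof.
move=> ov; apply: mp_appE; split; first exact: (carrier_subspace T).1.
by exists v; rewrite // app0 add0r.
Qed.

End MoorePenrose.

(* Main.v *)
(* Write T' for the adjoint, y = T x + v with x in the carrier of T and v
   orthogonal to R(T), and x = T' w + u with w in the carrier of T' and u
   orthogonal to R(T').  Projecting (u, 0) onto the graph of the closure of T
   shows that u lies in its null space, which is the closure of N(T).  But
   u = x - T' w is also orthogonal to N(T), so u = 0 and y = T T' w + v.  Since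
   N(T T') = N(T'), w is in the carrier of T T', so it is the value at y of the
   Moore-Penrose inverse of T T'. *)

Require Import Defs.
From HB Require Import structures.
From mathcomp Require Import all_boot all_order all_algebra.
From mathcomp Require Import sesquilinear complex ring.
From mathcomp Require Import all_classical reals prodnormedzmodule.
From mathcomp Require Import topology normedtype.

Set Implicit Arguments.
Unset Strict Implicit.
Unset Printing Implicit Defensive.

Import Order.TTheory GRing.Theory Num.Theory.
Import numFieldNormedType.Exports.

Local Open Scope classical_set_scope.
Local Open Scope ring_scope.

(** * Completeness of products and infima of scalars *)

Lemma prod_cauchy_cvg (R : numFieldType) (E F : completeNormedModType R)
    (G : set_system (E * F)%type) : ProperFilter G -> cauchy G ->
  exists p : E * F, G --> p.
Proof.
move=> PG /cauchyP cG.
have c1 : cvg (fst @ G).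
  apply/cauchy_cvgP/cauchyP => e /cG[x Gx]; exists x.1.
  suff : G (fst @^-1` ball x.1 e) by [].
  by apply: filterS Gx => y [].
have c2 : cvg (snd @ G).
  apply/cauchy_cvgP/cauchyP => e /cG[x Gx]; exists x.2.
  suff : G (snd @^-1` ball x.2 e) by [].
  by apply: filterS Gx => y [].
exists (lim (fst @ G), lim (snd @ G)).
move=> A /(cvg_pair c1 c2) GA.
suff : G ((fun x => (x.1, x.2)) @^-1` A) by apply: filterS => -[].
exact: GA.
Qed.

Lemma mul_sconj (R : realType) (k : scalar_kind) (c : scalars R k) :
  c * sconj R k c = `|c| ^+ 2.
Proof.
case: k c => /= c; last by rewrite normCK.
by rewrite real_normK ?num_real // expr2.
Qed.

(** Nonnegative complex numbers are real, so the complex case reduces to an infimum of real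
    parts. *)
Lemma scalars_inf (R : realType) (k : scalar_kind) (A : set (scalars R k)) :
  A !=set0 -> (forall x, A x -> 0 <= x) ->
  exists2 d, forall x, A x -> d <= x &
    forall e, 0 < e -> exists2 x, A x & x < d + e.
Proof.
have real_inf (B : set R) : B !=set0 -> (forall x, B x -> 0 <= x) ->
    exists2 d, forall x, B x -> d <= x &
      forall e, 0 < e -> exists2 x, B x & x < d + e.
  move=> B0 B_ge0; have lB : has_lbound B by exists 0 => x /B_ge0.
  exists (inf B) => [x Bx|e e0]; first exact: ge_inf.
  exact: inf_adherent.
case: k A => /=; first exact: real_inf.
move=> A [a Aa] A_ge0.
have reE (x : R[i]%C) : 0 <= x -> x = (complex.Re x)%:C%C.
  by case: x => x y; rewrite lecE /= => /andP[/eqP -> _].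
have [||d dA Ad] := real_inf [set x | A x%:C%C].
- by exists (complex.Re a); rewrite /= -reE // A_ge0.
- by move=> x /A_ge0; rewrite lecE /= eqxx.
exists d%:C%C => [x Ax|e e0].
  have xE := reE _ (A_ge0 _ Ax).
  by rewrite xE lecR; apply: dA; rewrite /= -xE.
have eE := reE _ (ltW e0).
have [|x Ax xe] := Ad (complex.Re e); first by rewrite -ltcR -eE.
by exists x%:C%C => //; rewrite eE -rmorphD ltcR.
Qed.

(** * Inequalities for inner products *)

Section DotInequalities.
Variables (R : realType) (k : scalar_kind) (E : lmodType (scalars R k)).
Variable B : {dot E for sconj R k}.

Lemma dotxx_ge0 (x : E) : 0 <= B x x.
Proof.
have [->|x0] := eqVneq x 0; first by rewrite linear0l.
by rewrite ltW // neq0_dnorm_gt0.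
Qed.

(* The quadratic polynomial in the hypothesis is evaluated at its minimizer
   [a = B x g / B g g]. *)
Lemma dot_le_of_almost_minimal (x g : E) e :
  (forall a, B x x <= B (x - a *: g) (x - a *: g) + e) ->
  `|B x g| ^+ 2 <= e * B g g.
Proof.
move=> minx; have [->|g0] := eqVneq g 0.
  by rewrite !linear0r normr0 mulr0 expr0n.
have Bg : 0 < B g g by exact: neq0_dnorm_gt0.
have thBg : sconj R k (B g g) = B g g by rewrite {2}(hermC B) expr0 mul1r.
have BgC : B g g != 0 by rewrite gt_eqF.
have := minx (B x g / B g g).
set a := B x g / B g g.
have tha : sconj R k a = sconj R k (B x g) / B g g.
  by rewrite rmorphM fmorphV thBg.
have d1 : B x (a *: g) = `|B x g| ^+ 2 / B g g.
  by rewrite linearZr_LR /= tha mulrAC -mul_sconj (mulrC (B x g)).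
have d2 : B (a *: g) (a *: g) = `|B x g| ^+ 2 / B g g.
  by rewrite linearZl_LR linearZr_LR /= tha mulfVK // mulrAC mul_sconj.
have thd : sconj R k (`|B x g| ^+ 2 / B g g) = `|B x g| ^+ 2 / B g g.
  rewrite rmorphM fmorphV thBg -mul_sconj rmorphM.
  congr (_ / _); rewrite mulrC; congr (_ * _).
  by case: (k) (B x g) => //= c; rewrite conjCK.
(* By [d1], [d2] and [thd] the quadratic term and both cross terms share one value, so the expansion
   is [B x x] minus that value. *)
rewrite hnormB /= d1 d2 thd expr0 mul1r opprD addrACA subrr addr0.
rewrite -addrA lerDl addrC subr_ge0 ler_pdivrMr //.
Qed.

(** With [e := B x x] the almost-minimality hypothesis is mere positivity. *)
Lemma dot_CauchySchwarz (x y : E) : `|B x y| ^+ 2 <= B x x * B y y.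
Proof. by apply: dot_le_of_almost_minimal => a; rewrite lerDr dotxx_ge0. Qed.

Lemma dot_parallelogram (x y : E) :
  B (x - y) (x - y) + B (x + y) (x + y) = (B x x + B y y) *+ 2.
Proof. by rewrite hnormB hnormD /= addrACA addNr addr0 mulr2n. Qed.

End DotInequalities.

(* The projection theorem is stated for a form whose norm is only equivalent to
   that of [E], because the norm of the product [H * K] is the max norm. *)
Section Projection.
Variables (R : realType) (k : scalar_kind) (E : normedModType (scalars R k)).
Variables (B : {dot E for sconj R k}) (M : scalars R k).
Hypothesis M_ge0 : 0 <= M.
Hypothesis dot_bounded : forall x y, `|B x y| <= M * `|x| * `|y|.

(** Continuity of [B] in its first argument, in the form that lets orthogonality pass to a limit. *)
Lemma dot_eq0_near (x y : E) :
  (forall r, 0 < r -> exists2 x', `|x - x'| < r & `|B x' y| < r) -> B x y = 0.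
Proof.
move=> nearx; apply/eqP/negPn/negP => Bxy0.
have c0 : 0 < `|B x y| by rewrite normr_gt0.
have My : 0 < M * `|y| + 1 by rewrite ltr_wpDl // mulr_ge0.
have [|x' xx' Bx'] := nearx (`|B x y| / (M * `|y| + 1)); first exact: divr_gt0.
move: xx' Bx'; set r := _ / _ => xx' Bx'.
suff : `|B x y| < r * (M * `|y| + 1) by rewrite divfK ?gt_eqF // ltxx.
rewrite -{1}(subrK x' x) linearDl /= (le_lt_trans (ler_normD _ _)) //.
rewrite mulrDr mulr1 ler_ltD // (le_trans (dot_bounded _ _)) //.
by rewrite mulrAC mulrC ler_wpM2r ?mulr_ge0 // ltW.
Qed.

Hypothesis dot_coercive : forall x, `|x| ^+ 2 <= B x x.
Hypothesis E_complete :
  forall F : set_system E, ProperFilter F -> cauchy F -> exists p : E, F --> p.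

(** Near-minimizers of the squared distance to [w] form a Cauchy filter by the parallelogram law.
    Their residuals are almost orthogonal to [G], so the residual of the limit is orthogonal. *)
Lemma closed_projection (G : set E) (w : E) :
  G 0 -> (forall a x y, G x -> G y -> G (a *: x + y)) -> closed G ->
  exists2 p, G p & forall g, G g -> B (w - p) g = 0.
Proof.
move=> G0 GP clG.
have [||d dmin dinf] := @scalars_inf R k [set B (w - g) (w - g) | g in G].
- by exists (B (w - 0) (w - 0)); exists 0.
- by move=> _ [g _ <-]; exact: dotxx_ge0.
pose S e := [set g | G g /\ B (w - g) (w - g) < d + e].
pose F := filter_from [set e | 0 < e] S.
have PF : ProperFilter F.
  apply: filter_from_proper; last first.
    by move=> e /dinf[_ [g Gg <-] ge]; exists g.
  apply: filter_from_filter; first by exists 1 => /=.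
  move=> e e' /= e0 e'0.
  (* The order on complex scalars is partial, but positive scalars are real and hence comparable. *)
  have [le|/ltW le] := real_leP (gtr0_real e0) (gtr0_real e'0).
    by exists e => // g [Gg ge]; split; split=> //;
      rewrite (lt_le_trans ge) ?lerD2l.
  by exists e' => // g [Gg ge]; split; split=> //;
    rewrite (lt_le_trans ge) ?lerD2l.
have cF : cauchy F.
  apply: cauchy_exP => e e0.
  (* The midpoint of two near-minimizers lies in [G], so its squared distance is at least [d]. The
     parallelogram law then bounds [B (z - z') (z - z')] by [4 * (d + e ^+ 2 / 4) - 4 * d], which is
     [e ^+ 2]. *)
  have e4 : 0 < e ^+ 2 / 4 by rewrite divr_gt0 ?exprn_gt0.
  have [_ [z Gz <-] ze] := dinf _ e4.
  exists z; exists (e ^+ 2 / 4) => // z' [Gz' ze'].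
  rewrite -ball_normE /= -(ltr_pXn2r (isT : 0 < 2)%N) ?nnegrE ?(ltW e0) //.
  apply: le_lt_trans (dot_coercive _) _.
  have Gm : G (2^-1 *: z + 2^-1 *: z').
    by apply: (GP) => //; rewrite -[_ *: z']addr0; exact: GP.
  have dm := dmin _ (ex_intro2 _ _ _ Gm erefl).
  have := dot_parallelogram B (w - z') (w - z).
  have -> : (w - z') - (w - z) = z - z'.
    by rewrite opprB addrC addrA subrK.
  have -> : (w - z') + (w - z) = 2 *: (w - (2^-1 *: z + 2^-1 *: z')).
    rewrite scalerBr scalerDr !scalerA divff ?pnatr_eq0 // !scale1r.
    by rewrite scaler_nat mulr2n addrACA opprD [- z' - z]addrC.
  rewrite linearZl_LR linearZr_LR /= rmorph_nat => /(canRL (addrK _)) ->.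
  have -> : e ^+ 2 =
      (d + e ^+ 2 / 4 + (d + e ^+ 2 / 4)) *+ 2 - 2 * (2 * d) by field.
  apply: ltr_leD; first by rewrite ltr_pMn2r // ltrD.
  by rewrite lerN2 !ler_pM2l.
have [p Fp] := E_complete PF cF.
have Gp : G p.
  apply: clG => U /Fp FU.
  have FG : F G by exists 1 => //= g [].
  by have [x []] := filter_ex (filterI FG FU); exists x.
exists p => // g Gg; apply: dot_eq0_near => r r0.
have Bg : 0 < B g g + 1 by rewrite ltr_wpDl // dotxx_ge0.
(* Chosen so that [e * B g g < r ^+ 2]; adding 1 keeps the divisor positive when [g] is 0. *)
pose e := r ^+ 2 / (B g g + 1).
have e0 : 0 < e by rewrite divr_gt0 ?exprn_gt0.
have FS : F (S e) by exists e.
have Fb : F (ball p r) by apply: Fp; exact: nbhsx_ballx.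
have [z [[Gz ze]]] := filter_ex (filterI FS Fb).
rewrite -ball_normE /= => pz; exists (w - z).
  by rewrite opprB addrCA addrAC subrr add0r -opprB normrN.
rewrite -(ltr_pXn2r (isT : 0 < 2)%N) ?nnegrE ?(ltW r0) //.
apply: (@le_lt_trans _ _ (e * B g g)).
  apply: dot_le_of_almost_minimal => a; rewrite (le_trans (ltW ze)) // lerD2r.
  by apply: dmin; exists (a *: g + z); [exact: GP | rewrite opprD addrCA addrC].
by rewrite -[ltRHS](divfK (lt0r_neq0 Bg)) ltr_pM2l // ltrDl.
Qed.

End Projection.

(** * Orthogonality and projections in Hilbert spaces and their products *)

Section HilbertGeometry.
Variables (R : realType) (k : scalar_kind).
Implicit Types H K : hilbertType R k.

Lemma hilbert_dot_bounded H (x y : H) : `|'[x, y]| <= 1 * `|x| * `|y|.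
Proof.
rewrite mul1r -(ler_pXn2r (isT : 0 < 2)%N) ?nnegrE ?mulr_ge0 //.
by rewrite exprMn -!dot_norm dot_CauchySchwarz.
Qed.

Lemma orth_closed H (A : set H) : closed (orth A).
Proof.
move=> x clx y Ay; apply: (dot_eq0_near ler01 (@hilbert_dot_bounded H)) => r r0.
have [x' [ox']] := clx _ (nbhsx_ballx x _ r0).
by rewrite -ball_normE => xx'; exists x'; rewrite // ox' ?normr0.
Qed.

(** The complement of [u] is closed and contains [A], hence contains [u] itself. *)
Lemma closure_orth_eq0 H (A : set H) u : closure A u -> orth A u -> u = 0.
Proof.
move=> clu ou; apply/dot_eq0.
have Au : A `<=` orth [set u].
  by move=> y Ay _ ->; rewrite dotC ou // rmorph0.
by apply: (orth_closed (closureS Au clu)).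
Qed.

Lemma hilbert_projection H (G : set H) w : linear_subspace G -> closed G ->
  exists2 p, G p & orth G (w - p).
Proof.
move=> [G0 GP] clG.
apply: (closed_projection ler01 (@hilbert_dot_bounded H)) => //.
  by move=> x; rewrite dot_norm.
by move=> F FF cF; exists (lim F); exact: cauchy_cvg.
Qed.

Section PairDot.
Variables H K : hilbertType R k.

Definition pair_dot (p q : H * K) : scalars R k := '[p.1, q.1] + '[p.2, q.2].

Lemma pair_dot_bilinear :
  bilinear_for *%R (sconj R k \; *%R) pair_dot.
Proof.
split=> q a x y; rewrite /pair_dot /=; first by rewrite !dotPl mulrDr addrACA.
by rewrite !dotPr mulrDr addrACA.
Qed.

HB.instance Definition _ := @bilinear_isBilinear.Build (scalars R k)
  (H * K)%type (H * K)%type (scalars R k) *%R (sconj R k \; *%R)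
  pair_dot pair_dot_bilinear.

Lemma pair_dot_hermitian p q :
  pair_dot p q = (-1) ^+ false * sconj R k (pair_dot q p).
Proof. by rewrite expr0 mul1r rmorphD /= -!dotC. Qed.

HB.instance Definition _ := @isHermitianSesquilinear.Build (scalars R k)
  (H * K)%type false (sconj R k) pair_dot pair_dot_hermitian.

Lemma pair_dot_gt0 p : p != 0 -> 0 < pair_dot p p.
Proof.
rewrite /pair_dot !dot_norm; case: p => x y.
rewrite -pair_eqE /= negb_and => xy0.
rewrite lt0r paddr_eq0 ?exprn_ge0 // !expf_eq0 !normr_eq0 /= negb_and xy0.
by rewrite addr_ge0 ?exprn_ge0.
Qed.

HB.instance Definition _ := @isDotProduct.Build (scalars R k)
  (H * K)%type pair_dot pair_dot_gt0.

Lemma norm_fst_le (p : H * K) : `|p.1| <= `|p|.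
Proof.
by rewrite prod_normE comparable_le_max ?real_comparable ?normr_real ?lexx.
Qed.

Lemma norm_snd_le (p : H * K) : `|p.2| <= `|p|.
Proof.
rewrite prod_normE comparable_le_max ?real_comparable ?normr_real //.
by rewrite lexx orbT.
Qed.

Lemma pair_dot_bounded (p q : H * K) : `|pair_dot p q| <= 2 * `|p| * `|q|.
Proof.
rewrite -mulrA mulr_natl mulr2n (le_trans (ler_normD _ _)) // lerD //.
  rewrite (le_trans (hilbert_dot_bounded _ _)) // mul1r.
  by rewrite ler_pM ?norm_fst_le.
rewrite (le_trans (hilbert_dot_bounded _ _)) // mul1r.
by rewrite ler_pM ?norm_snd_le.
Qed.

(** The square of the max norm is one of the two summands. *)
Lemma pair_dot_coercive (p : H * K) : `|p| ^+ 2 <= pair_dot p p.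
Proof.
rewrite /pair_dot !dot_norm prod_normE.
by rewrite /Order.max; case: ifP => _; rewrite ?lerDr ?lerDl exprn_ge0.
Qed.

Lemma pair_closed_projection (G : set (H * K)) w :
  G 0 -> (forall a p q, G p -> G q -> G (a *: p + q)) -> closed G ->
  exists2 p, G p & forall q, G q -> pair_dot (w - p) q = 0.
Proof.
move=> G0 GP clG.
apply: (closed_projection (ler0n _ 2) pair_dot_bounded pair_dot_coercive) => //.
exact: prod_cauchy_cvg.
Qed.

End PairDot.

End HilbertGeometry.

(** * Decomposable domains *)

Section OperatorTheory.
Variables (R : realType) (k : scalar_kind) (H K : hilbertType R k).
Implicit Types T : operator H K.

Lemma null_carrier_sub T : osum (null T) (carrier T) `<=` dom T.
Proof.
move=> _ [x [Dx _] [y [Dy _] <-]]; rewrite -[x]scale1r.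
exact: (dom_subspace T).2.
Qed.

(** Subtracting from [x] its projection onto [null T] stays in [dom T], since [null T] is contained
    in it. *)
Lemma closed_null_decomposable T : closed (null T) -> decomposable T.
Proof.
move=> clN; apply/seteqP; split; last exact: null_carrier_sub.
move=> x Dx; have [n Nn on] := hilbert_projection x (null_subspace T) clN.
exists n => //; exists (x - n); last by rewrite addrC subrK.
by split=> //; have [] := appB Dx Nn.1.
Qed.

End OperatorTheory.

(** * The adjoint and its product with [T] *)

Section Adjoint.
Variables (R : realType) (k : scalar_kind) (H K : hilbertType R k).
Variables (T : operator H K) (dsT : densely_defined T).
Local Notation Ts := (adjoint dsT).

Lemma adjoint_dot x y : dom T x -> dom Ts y -> '[T x, y] = '[x, Ts y].
Proof. by move=> Dx Dy; have /adjointP := conj Dy (erefl (Ts y)); apply. Qed.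

Lemma null_adjoint : null Ts = orth (ran T).
Proof.
apply/seteqP; split=> y.
  move=> [Dy Tsy] _ [x Dx <-].
  by rewrite dotC adjoint_dot // Tsy dot0r rmorph0.
move=> oy; apply/adjointP => x Dx.
by rewrite dot0r dotC oy ?rmorph0 //; exists x.
Qed.

Lemma ran_adjoint_sub_orth_null : ran Ts `<=` orth (null T).
Proof.
move=> _ [y Dy <-] x [Dx Tx].
by rewrite dotC -adjoint_dot // Tx dot0l rmorph0.
Qed.

(** If [T (Ts y) = 0], then [Ts y] lies both in [null T] and in its orthogonal complement, so it
    vanishes. *)
Lemma null_comp_adjoint : null (comp_op T Ts) = null Ts.
Proof.
apply/seteqP; split=> y.
  move=> [[Dy DTsy] TTsy]; split=> //.
  apply: (@orth_self _ _ _ (null T)); first by [].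
  by apply: ran_adjoint_sub_orth_null; exists y.
move=> [Dy Tsy]; have [D0 _] := dom_subspace T.
have DTsy : dom T (Ts y) by rewrite Tsy.
split; first by split.
have -> : comp_op T Ts y = T (Ts y) by [].
by rewrite Tsy app0.
Qed.

Lemma adjoint_decomposable : decomposable Ts.
Proof.
by apply: closed_null_decomposable; rewrite null_adjoint; exact: orth_closed.
Qed.

Lemma comp_adjoint_decomposable : decomposable (comp_op T Ts).
Proof.
apply: closed_null_decomposable; rewrite null_comp_adjoint null_adjoint.
exact: orth_closed.
Qed.

(* A vector [(a, b)] orthogonal to the graph of [T] satisfies [T^* b = - a], so
   [(u, 0)] is orthogonal to all of them; hence [(u, 0)] equals its projection
   onto the graph of [S]. *)
Lemma orth_ran_adjoint_null (S : operator H K) u :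
  closed_op S -> extends S T -> orth (ran Ts) u -> null S u.
Proof.
move=> clS [DTS ETS] ou.
have [D0 DP] := dom_subspace S.
have [|||[x y] [/= Dx Sx] oxy] :=
  @pair_closed_projection _ _ H K (graph S) (u, 0).
- by split=> //=; exact: app0.
- move=> a [x y] [x' y'] [/= Dx <-] [/= Dx' <-].
  by split; [exact: DP | rewrite /= app_linear].
- exact: clS.
have /adjointP[Dy Tsy] : adjoint_rel T y (u - x).
  move=> z Dz; have := oxy (z, T z).
  rewrite /pair_dot /= sub0r => /(_ (conj (DTS _ Dz) (ETS _ Dz))).
  (* Conjugation swaps the arguments, since [adjoint_rel] has [T z] on the left. *)
  move=> /(congr1 (sconj R k)); rewrite rmorphD rmorph0 /= -!dotC.
  by rewrite linearNr /= => /eqP; rewrite subr_eq0 => /eqP.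
(* The residual is orthogonal to [(u, 0)], because [u - x = Ts y] is in the range of [Ts], and to
   the projection [(x, y)]; hence to itself. *)
have uxy : pair_dot (u - x, - y) (u - x, - y) = 0.
  have -> : pair_dot (u - x, - y) (u - x, - y) =
      pair_dot (u - x, - y) (u, 0) - pair_dot (u - x, - y) (x, y).
    by rewrite /pair_dot /= dot0r addr0 dotBr linearNr opprD addrA.
  have -> : pair_dot (u - x, - y) (x, y) = 0.
    by rewrite -(oxy (x, y)) //; congr pair_dot; congr pair; rewrite sub0r.
  rewrite subr0 /pair_dot /= dot0r addr0 dotC ou ?rmorph0 //.
  by exists y.
have /eqP : (u - x, - y) = 0 :> H * K.
  by apply/eqP/negPn/negP => /pair_dot_gt0; rewrite uxy ltxx.
rewrite -pair_eqE /= subr_eq0 oppr_eq0 => /andP[/eqP -> /eqP y0].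
by split; rewrite ?Sx.
Qed.

End Adjoint.

Theorem theorem2p7 (R : realType) (k : scalar_kind) (H K : hilbertType R k)
    (T : operator H K)
    (dsT : densely_defined T) (clT : closable T) (decT : decomposable T)
    (nullT : null (closure_op clT) = closure (null T)) :
  let Ts := adjoint dsT in
  exists (decTs : decomposable Ts) (decTTs : decomposable (comp_op T Ts)),
    extends (mp decTTs) (comp_op (mp decTs) (mp decT)).
Proof.
move=> Ts; exists (adjoint_decomposable dsT), (comp_adjoint_decomposable dsT).
set decTs := adjoint_decomposable dsT.
set decTTs := comp_adjoint_decomposable dsT.
(* [mp_rel] yields both the membership of [y] in the larger domain and the value there. *)
suff key y : dom (comp_op (mp decTs) (mp decT)) y ->
    mp_rel (comp_op T Ts) y (mp decTs (mp decT y)).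
  split=> y /key yw; last exact: mp_appE.
  case: yw => -[Dw _] [v ov ->].
  exists (comp_op T Ts (mp decTs (mp decT y))); last by exists v.
  by eexists; [exact: Dw|].
move=> [/(mp_domP decT)[x yx]]; rewrite /= (mp_appE yx).
move=> /(mp_domP decTs)[w xw]; rewrite (mp_appE xw).
case: yx => -[Dx ox] [v ov ->]; case: xw => -[Dw ow] [u ou xE].
have u0 : u = 0.
  apply: (@closure_orth_eq0 _ _ _ (null T)).
    rewrite -nullT; apply: (orth_ran_adjoint_null _ _ ou).
      exact: closure_op_closed.
    exact: closure_op_extends.
  have -> : u = (-1) *: Ts w + x by rewrite xE scaleN1r addrA addNr add0r.
  apply: (orth_subspace _).2 => //.
  by apply: (ran_adjoint_sub_orth_null (dsT := dsT)); exists w.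
rewrite u0 addr0 in xE.
have DTw : dom T (Ts w) by rewrite -xE.
split; first by split; [split | rewrite null_comp_adjoint].
exists v; last by rewrite xE.
(* The range of [T Ts] lies in that of [T], so [v] is orthogonal to it. *)
by move=> _ [z [Dz DTz] <-]; apply: ov; exists (Ts z).
Qed.
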